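(* Let $L$ be a differential vector space over a field $\mathbf F$ with differential operator $\partial$, let $Q$ be a set of seminorms on $L$, and let $r: L_{\omega Q}\to L^\omega$ be an additive section of the bundle $(L^\omega,\pi_Q,L_{\omega Q})$. Then for any elements $F$ and $G$ of the hyperspace $L_{\omega Q}$, $$\frac{\partial}{\partial r}(F+G)=\frac{\partial}{\partial r}F+\frac{\partial}{\partial r}G .$$
   Context: $\mathbf F$ is a field with an absolute value $|\cdot|$ (e.g. $\mathbb R$ or $\mathbb C$). A seminorm on $L$ is a map $q:L\to[0,\infty)$ with $q(ax)=|a|q(x)$ and $q(x+y)\le q(x)+q(y)$. $L^\omega$ is the vector space of all sequences $(f_i)_{i\in\omega}$ in $L$ ($i=1,2,3,\dots$) with coordinatewise operations. For $f=(f_i),g=(g_i)\in L^\omega$, $f\approx_Q g$ means $\lim_{i\to\infty}q(f_i-g_i)=0$ for every $q\in Q$; this is an equivalence relation. The hyperspace $L_{\omega Q}$ is the set of equivalence classes $\mathrm{Hs}_Q(f_i)_{i\in\omega}$, a vector space with $\mathrm{Hs}_Q(f_i)+\mathrm{Hs}_Q(g_i)=\mathrm{Hs}_Q(f_i+g_i)$ and $a\,\mathrm{Hs}_Q(f_i)=\mathrm{Hs}_Q(af_i)$. $\pi_Q:L^\omega\to L_{\omega Q}$ is the natural projection. $L$ is a differential vector space: it carries a partially defined multiplication and a linear map $\partial:L\to L$ such that $\partial(f\cdot g)=(\partial f)\cdot g+f\cdot(\partial g)$ whenever $f\cdot g$ is defined. $\partial$ is extended to $L^\omega$ by $\partial(f_i)_{i\in\omega}=(\partial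 f_i)_{i\in\omega}$. A section is a map $r:L_{\omega Q}\to L^\omega$ (no linearity or continuity required) with $\pi_Q\circ r=\mathrm{id}$. It is additive if $r(x+y)=r(x)+r(y)$ for all $x,y\in L_{\omega Q}$. The sectional derivative is the map $\frac{\partial}{\partial r}:L_{\omega Q}\to L_{\omega Q}$, $\frac{\partial}{\partial r}F=\pi_Q(\partial(r(F)))$. *)

(* Defs.v *)
From HB Require Import structures.
From mathcomp Require Import all_boot all_order all_algebra.
From mathcomp Require Import all_classical all_reals all_analysis.

Set Implicit Arguments.
Unset Strict Implicit.
Unset Printing Implicit Defensive.
Import Order.TTheory GRing.Theory Num.Theory.
Import numFieldNormedType.Exports.
Local Open Scope classical_set_scope.
Local Open Scope quotient_scope.
Local Open Scope ring_scope.

Record absolute_value (R : realType) (F : fieldType) := AbsoluteValue {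
  absv :> F -> R ;
  absv_ge0 : forall a, 0 <= absv a ;
  absv_eq0 : forall a, absv a = 0 <-> a = 0 ;
  absvM : forall a b, absv (a * b) = absv a * absv b ;
  absvD : forall a b, absv (a + b) <= absv a + absv b }.

Record seminorm (R : realType) (F : fieldType) (abs : absolute_value R F)
    (L : lmodType F) := Seminorm {
  snorm :> L -> R ;
  snorm_ge0 : forall x, 0 <= snorm x ;
  snormZ : forall a x, snorm (a *: x) = abs a * snorm x ;
  snormD : forall x y, snorm (x + y) <= snorm x + snorm y }.

(* [pmul f g = None] means that the product of [f] and [g] is undefined.  The
   Leibniz equation is an equation between defined elements: when [f . g] is
   defined, so are the two products on its right-hand side. *)
HB.mixin Record isDiffVectorSpace (F : fieldType) L of GRing.Lmodule F L := {
  pmul : L -> L -> option L ;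
  deriv_op : L -> L ;
  deriv_op_linear : linear deriv_op ;
  deriv_op_leibniz : forall f g h, pmul f g = Some h ->
    exists u v, [/\ pmul (deriv_op f) g = Some u, pmul f (deriv_op g) = Some v
                  & deriv_op h = u + v] }.

#[short(type="diffVectType")]
HB.structure Definition DiffVectorSpace (F : fieldType) :=
  { L of GRing.Lmodule F L & isDiffVectorSpace F L }.

HB.instance Definition _ (F : fieldType) (L : diffVectType F) :=
  GRing.isLinear.Build F L L *:%R (@deriv_op F L) (@deriv_op_linear F L).

Section Hyperspace.
Variables (R : realType) (F : fieldType) (abs : absolute_value R F).
Variables (L : lmodType F) (Q : set (seminorm abs L)).
Implicit Types (f g h : nat -> L).

Definition approx f g : Prop :=
  forall q, Q q -> q (f i - g i) @[i --> \oo] --> 0.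

Lemma snorm0 (q : seminorm abs L) : q 0 = 0.
Proof. by rewrite -(scale0r 0) snormZ (absv_eq0 abs 0).2 // mul0r. Qed.

Lemma approxZ a f g : approx f g -> approx (a *: f) (a *: g).
Proof.
move=> fg q Qq; rewrite -(mulr0 (abs a)).
under eq_fun do rewrite -scalerBr snormZ.
by apply: cvgMl_tmp; exact: fg.
Qed.

Lemma approx_refl f : approx f f.
Proof.
by move=> q _; under eq_fun do rewrite subrr snorm0; exact: cvg_cst.
Qed.

Lemma approx_opp f g : approx f g -> approx (- f) (- g).
Proof. by rewrite -!scaleN1r; exact: approxZ. Qed.

Lemma approx_sym f g : approx f g -> approx g f.
Proof.
move=> /approx_opp fg q Qq.
rewrite (_ : (fun i => q (g i - f i)) = (fun i => q ((- f) i - (- g) i))).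
  exact: fg.
by apply/funext => i; rewrite !fctE opprK addrC.
Qed.

Lemma approx_add f f' g g' :
  approx f f' -> approx g g' -> approx (f + g) (f' + g').
Proof.
move=> ff' gg' q Qq.
apply: (@squeeze_cvgr _ _ _ _ (cst 0)
  (fun i => q (f i - f' i) + q (g i - g' i))).
- apply: nearW => i; rewrite snorm_ge0 /= opprD addrACA; exact: snormD.
- exact: cvg_cst.
- by rewrite -[X in _ --> X]addr0; apply: cvgD; [exact: ff'|exact: gg'].
Qed.

Lemma approx_trans f g h : approx f g -> approx g h -> approx f h.
Proof.
move=> fg gh q Qq; have := approx_add fg gh Qq.
rewrite (_ : (fun i => q ((f + g) i - (g + h) i)) = (fun i => q (f i - h i)))//.
by apply/funext => i; rewrite !fctE opprD addrA addrK.
Qed.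

Definition approxb : rel (nat -> L) := fun f g => `[< approx f g >].

Lemma approxb_refl : reflexive approxb.
Proof. by move=> f; apply/asboolP/approx_refl. Qed.
Lemma approxb_sym : symmetric approxb.
Proof. by move=> f g; apply/asboolP/asboolP => /approx_sym. Qed.
Lemma approxb_trans : transitive approxb.
Proof.
move=> g f h /asboolP fg /asboolP gh; apply/asboolP; exact: approx_trans gh.
Qed.

Canonical approx_equiv :=
  EquivRel approxb approxb_refl approxb_sym approxb_trans.

Definition hyperspace := {eq_quot approx_equiv}.
HB.instance Definition _ := Choice.on hyperspace.
HB.instance Definition _ := EqQuotient.on hyperspace.

Definition hs_pi (f : nat -> L) : hyperspace := \pi f.

Lemma hs_piP f g : hs_pi f = hs_pi g <-> approx f g.
Proof. by split => [/eqmodP/asboolP|fg]//; apply/eqmodP/asboolP. Qed.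

Lemma hs_piK (x : hyperspace) : hs_pi (repr x) = x.
Proof. exact: reprK. Qed.

Lemma approx_repr f : approx (repr (hs_pi f)) f.
Proof. by apply/hs_piP; rewrite hs_piK. Qed.

Definition hs_zero : hyperspace := hs_pi 0.
Definition hs_opp (x : hyperspace) := hs_pi (- repr x).
Definition hs_add (x y : hyperspace) := hs_pi (repr x + repr y).
Definition hs_scale (a : F) (x : hyperspace) := hs_pi (a *: repr x).

Lemma hs_oppE f : hs_opp (hs_pi f) = hs_pi (- f).
Proof. exact/hs_piP/approx_opp/approx_repr. Qed.
Lemma hs_addE f g : hs_add (hs_pi f) (hs_pi g) = hs_pi (f + g).
Proof. by apply/hs_piP/approx_add; exact: approx_repr. Qed.
Lemma hs_scaleE a f : hs_scale a (hs_pi f) = hs_pi (a *: f).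
Proof. exact/hs_piP/approxZ/approx_repr. Qed.

Lemma hs_addA : associative hs_add.
Proof.
by move=> x y z; rewrite -(hs_piK x) -(hs_piK y) -(hs_piK z) !hs_addE addrA.
Qed.
Lemma hs_addC : commutative hs_add.
Proof. by move=> x y; rewrite -(hs_piK x) -(hs_piK y) !hs_addE addrC. Qed.
Lemma hs_add0 : left_id hs_zero hs_add.
Proof. by move=> x; rewrite -(hs_piK x) hs_addE add0r. Qed.
Lemma hs_addN : left_inverse hs_zero hs_opp hs_add.
Proof. by move=> x; rewrite -(hs_piK x) hs_oppE hs_addE addNr. Qed.

HB.instance Definition _ :=
  GRing.isZmodule.Build hyperspace hs_addA hs_addC hs_add0 hs_addN.

Lemma hs_scaleA a b x : hs_scale a (hs_scale b x) = hs_scale (a * b) x.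
Proof. by rewrite -(hs_piK x) !hs_scaleE scalerA. Qed.
Lemma hs_scale1 : left_id 1 hs_scale.
Proof. by move=> x; rewrite -(hs_piK x) hs_scaleE scale1r. Qed.
Lemma hs_scaleDr : right_distributive hs_scale +%R.
Proof.
move=> a x y; rewrite -(hs_piK x) -(hs_piK y).
by rewrite [_ + _]hs_addE !hs_scaleE scalerDr -hs_addE.
Qed.
Lemma hs_scaleDl x : {morph hs_scale^~ x : a b / a + b}.
Proof.
by move=> a b; rewrite -(hs_piK x) /= !hs_scaleE scalerDl -hs_addE.
Qed.

HB.instance Definition _ := GRing.Zmodule_isLmodule.Build F hyperspace
  hs_scaleA hs_scale1 hs_scaleDr hs_scaleDl.

Lemma hs_pi_linear : linear hs_pi.
Proof. by move=> a f g; rewrite -hs_addE -hs_scaleE. Qed.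

HB.instance Definition _ :=
  GRing.isLinear.Build F (nat -> L) hyperspace *:%R hs_pi hs_pi_linear.

Definition is_section (r : hyperspace -> nat -> L) : Prop :=
  cancel r hs_pi.

Definition is_additive (r : hyperspace -> nat -> L) : Prop :=
  {morph r : x y / x + y}.

End Hyperspace.

Definition seq_deriv (F : fieldType) (L : diffVectType F) (f : nat -> L) :
  nat -> L := fun i => deriv_op (f i).

Definition sectional_deriv (R : realType) (F : fieldType)
    (abs : absolute_value R F) (L : diffVectType F) (Q : set (seminorm abs L))
    (r : hyperspace Q -> nat -> L) (x : hyperspace Q) : hyperspace Q :=
  hs_pi Q (seq_deriv (r x)).

(* Main.v *)
Require Import Defs.
From HB Require Import structures.
From mathcomp Require Import all_boot all_order all_algebra.
From mathcomp Require Import all_classical all_reals all_analysis.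

Set Implicit Arguments.
Unset Strict Implicit.
Unset Printing Implicit Defensive.
Local Open Scope ring_scope.

(** The sectional derivative is the composite of [r], [seq_deriv] and [hs_pi], each additive: [r] by
    assumption, [seq_deriv] because [deriv_op] is linear at every index ([seq_derivD]), and [hs_pi]
    as the linear projection onto the quotient. *)

Lemma seq_derivD (K : fieldType) (L : diffVectType K) (f g : nat -> L) :
  seq_deriv (f + g) = seq_deriv f + seq_deriv g.
Proof. by apply/funext => i; exact: GRing.raddfD. Qed.

Theorem theorem3p1 (R : realType) (K : fieldType) (abs : absolute_value R K)
    (L : diffVectType K) (Q : set (seminorm abs L))
    (r : hyperspace Q -> nat -> L) :
  is_section r -> is_additive r ->
  forall F G : hyperspace Q,
    sectional_deriv r (F + G) = sectional_deriv r F + sectional_deriv r G.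
Proof.
(* The final [raddfD] is additivity of [hs_pi]: it turns a sum in [nat -> L] into a sum in the
   hyperspace. *)
by move=> _ rD F G; rewrite /sectional_deriv rD seq_derivD GRing.raddfD.
Qed.
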